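(* Let $X$ be a Banach space such that $\tilde{\varepsilon}_0^k(X)<2$ for some $k\in\mathbb{N}$. Then $X$ has the weak fixed point property for $\mathfrak{cm}$-nonexpansive maps: for every nonempty weakly compact convex $C\subset X$, every $\mathfrak{cm}$-nonexpansive map $T\colon C\to C$ has a fixed point.
   Context: For $k\in\mathbb{N}$, $s_k(X)$ is the supremum of the numbers $\varepsilon\in[0,2]$ for which there are $x_1,\dots,x_{k+1}\in B_X$ with $\min_{i\ne j}\|x_i-x_j\|\ge\varepsilon$. Define $\tilde\delta^k\colon[0,s_k(X))\to[0,1]$ by $\tilde\delta^k(\varepsilon)=\inf\{1-\|\frac1{k+1}\sum_{i=1}^{k+1}x_i\|:\ \{x_i\}_{i=1}^{k+1}\subset B_X,\ \min_{i\ne j}\|x_i-x_j\|\ge\varepsilon\}$, and $\tilde\varepsilon_0^k(X)=\sup\{\varepsilon\in[0,s_k(X)):\ \tilde\delta^k(\varepsilon)=0\}$. For a bounded convex set $C$, a nonexpansive map $T\colon C\to C$ is $\mathfrak{cm}$-nonexpansive if for all $n\in\mathbb{N}$, $y\in C$ and sequences $(u_i)_{i=1}^\infty\subset C$: $\limsup_{i\to\infty}\sup_{A\subset\{1,\dots,n\}}\|\sum_{k\in A}(Tu_{i+k}-Ty)\|\le\limsup_{i\to\infty}\sup_{A\subset\{1,\dots,n\}}\|\sum_{k\in A}(u_{i+k}-y)\|$. *)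

(* Defs.v *)
From HB Require Import structures.
From mathcomp Require Import all_boot all_order all_algebra.
From mathcomp Require Import all_classical all_reals all_analysis.
Unset Printing Implicit Defensive.
Import Order.TTheory GRing.Theory Num.Theory.
Import numFieldNormedType.Exports.
Local Open Scope classical_set_scope.
Local Open Scope ring_scope.

Section Defs.
Context {R : realType} {X : normedModType R}.

Definition sep_family (k : nat) (e : R) (x : 'I_k.+1 -> X) : Prop :=
  (forall i, `|x i| <= 1) /\ (forall i j, i != j -> e <= `|x i - x j|).

Definition s_k (k : nat) : R :=
  sup [set e : R | 0 <= e <= 2 /\ exists x, sep_family k e x].

(* \tilde\delta^k(e), meaningful for e in [0, s_k(X)) *)
Definition delta_k (k : nat) (e : R) : R :=
  inf [set 1 - `| (k.+1%:R)^-1 *: \sum_(i < k.+1) x i | | x in sep_family k e].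

Definition eps0_k (k : nat) : R :=
  sup [set e : R | 0 <= e < s_k k /\ delta_k k e = 0].

Definition cont_linear_functional (f : X -> R) : Prop :=
  (forall (a : R) (x y : X), f (a *: x + y) = a * f x + f y) /\ continuous f.

Definition weak_open (U : set X) : Prop :=
  forall x, U x -> exists (n : nat) (f : 'I_n -> X -> R) (e : R),
    [/\ 0 < e, (forall i, cont_linear_functional (f i)) &
        [set y | forall i, `|f i y - f i x| < e] `<=` U].

Definition weakly_compact (C : set X) : Prop :=
  forall (I : Type) (U : I -> set X),
    (forall i, weak_open (U i)) -> C `<=` \bigcup_i U i ->
    exists (n : nat) (g : 'I_n -> I), C `<=` \bigcup_(j in [set: 'I_n]) U (g j).

Definition convex (C : set X) : Prop :=
  forall x y (t : R), C x -> C y -> 0 <= t <= 1 -> C (t *: x + (1 - t) *: y).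

Definition nonexpansive_on (C : set X) (T : X -> X) : Prop :=
  forall x y, C x -> C y -> `|T x - T y| <= `|x - y|.

Definition cm_sup (v : nat -> X) (y : X) (n i : nat) : R :=
  \big[Num.max/0]_(A : {set 'I_n}) `| \sum_(k in A) (v (i + k.+1)%N - y) |.

Definition cm_nonexpansive (C : set X) (T : X -> X) : Prop :=
  nonexpansive_on C T /\
  forall (n : nat) (y : X) (u : nat -> X), C y -> (forall i, C (u i)) ->
    (limn_esup (fun i => (cm_sup (T \o u) (T y) n i)%:E)
     <= limn_esup (fun i => (cm_sup u y n i)%:E))%E.

End Defs.

(* Main.v *)
Require Import Defs.
From HB Require Import structures.
From mathcomp Require Import all_boot all_order all_algebra.
From mathcomp Require Import all_classical all_reals all_analysis.
From mathcomp Require Import ring lra zify.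
Import Order.TTheory GRing.Theory Num.Theory.
Import numFieldNormedType.Exports.
Local Open Scope classical_set_scope.
Local Open Scope ring_scope.

(** If [T] has no fixed point, take a minimal nonempty closed convex invariant
    subset [K] of [C], of diameter [D > 0], and an ultrafilter [U] of approximate
    fixed points in [K], with weak limit [a]. By Goebel-Karlovitz, approximate fixed
    points are at distance almost [D] from any given point of [K].

    For periodic sequences the cm condition says that [T] does not increase the
    maximum over [A] of [|sum_(k in A) (p_k - y)|], for any finitely many points
    [p_k], [y] of [C]. With Goebel-Karlovitz it forces
    [|sum_(k <= n) (z_k - y)|] to be almost [n D] for all [y] in [K] and [U]-most
    [z_k] (an l1-type estimate).

    For [z_1, ..., z_2n] chosen successively [U]-generically, weak convergence
    allows one to drop the negative terms of a signed sum of the [z_i - a] without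
    increasing the norm. Hence with [n = k + 1] the vectors [V_l = z_l - z_(n+l)],
    of norm at most [D], have a sum of norm almost [n D] and mutual distances almost
    [2 D], so that [eps0_k = 2]. *)

Set Implicit Arguments.
Unset Strict Implicit.

(** * Separation of convex sets *)

Section HahnBanach.
Context {R : realType} {X : normedModType R}.
Implicit Types (p q : X -> R) (x y z : X).

(** Homogeneity is an inequality for positive factors, which infima inherit; applied to [t^-1] it
    gives the equality of [sublinear_hom]. *)
Definition sublinear q :=
  (forall x y, q (x + y) <= q x + q y) /\
  (forall (t : R) x, 0 < t -> q (t *: x) <= t * q x).

Lemma le_inf_image (I : Type) (D : set I) (f : I -> R) (m : R) :
  D !=set0 -> (forall i, D i -> m <= f i) -> m <= inf (f @` D).
Proof.
move=> [i Di] mf; apply: lb_le_inf; first by exists (f i), i.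
by move=> _ [j Dj <-]; exact: mf.
Qed.

Lemma inf_image_le (I : Type) (D : set I) (f : I -> R) (m : R) (i : I) :
  D i -> (forall i, D i -> m <= f i) -> inf (f @` D) <= f i.
Proof.
move=> Di mf; apply: ge_inf; last by exists i.
by exists m => _ [j Dj <-]; exact: mf.
Qed.

(** Serves three times: for chains in Zorn's lemma, for the family indexed by [t >= 0] that forces
    linearity, and for the functional of [separation]. *)
Lemma inf_sublinear (I : Type) (D : set I) (F : I -> X -> R) :
  D !=set0 ->
  (forall i x, D i -> - `|x| <= F i x) ->
  (forall i j x y, D i -> D j ->
     exists2 k, D k & F k (x + y) <= F i x + F j y) ->
  (forall i (t : R) x, D i -> 0 < t -> exists2 k, D k & F k (t *: x) <= t * F i x) ->
  sublinear (fun x => inf [set F i x | i in D]).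
Proof.
move=> D0 Flb Fadd Fhom; split=> [x y|t x t0] /=.
  rewrite -lerBlDr; apply: le_inf_image => // i Di.
  rewrite lerBlDr -lerBlDl; apply: le_inf_image => // j Dj.
  rewrite lerBlDl; have [k Dk kle] := Fadd i j x y Di Dj.
  apply: le_trans kle.
  by apply: (@inf_image_le _ _ _ (- `|x + y|)) => // l Dl; exact: Flb.
rewrite -ler_pdivrMl//; apply: le_inf_image => // i Di.
rewrite ler_pdivrMl//; have [k Dk] := Fhom i t x Di t0; apply: le_trans.
by apply: (@inf_image_le _ _ _ (- `|t *: x|)) => // l Dl; exact: Flb.
Qed.

Lemma sublinear0 q : sublinear q -> (forall x, q x <= `|x|) -> q 0 = 0.
Proof.
move=> [qD _] qn; apply/eqP; rewrite eq_le; apply/andP; split.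
  by have := qn 0; rewrite normr0.
by have := qD 0 0; rewrite addr0; lra.
Qed.

Lemma sublinear_lb q x : sublinear q -> (forall x, q x <= `|x|) -> - `|x| <= q x.
Proof.
move=> sq qn; have := sublinear0 sq qn.
have := sq.1 x (- x); rewrite subrr; have := qn (- x); rewrite normrN; lra.
Qed.

Lemma sublinear_hom q t x : sublinear q -> (forall x, q x <= `|x|) ->
  0 <= t -> q (t *: x) = t * q x.
Proof.
move=> sq qn; rewrite le_eqVlt => /predU1P[<-|t0].
  by rewrite scale0r mul0r; exact: sublinear0.
apply/eqP; rewrite eq_le sq.2//= -ler_pdivlMl//.
have := sq.2 t^-1 (t *: x); rewrite invr_gt0 => /(_ t0).
by rewrite scalerA mulVf ?gt_eqF// scale1r.
Qed.

(* A minimal sublinear functional below p is linear: otherwise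
   [x |-> inf_(t >= 0) (q (x + t y) - t q y)] would be strictly smaller. *)
Lemma hahn_banach p : sublinear p -> (forall x, p x <= `|x|) ->
  exists g : X -> R, [/\ (forall a x y, g (a *: x + y) = a * g x + g y),
    forall x, g x <= p x & forall x, `|g x| <= `|x|].
Proof.
move=> sp pn.
pose T := {q | sublinear q /\ forall x, q x <= p x}.
have Tn (q : T) x : sval q x <= `|x| by apply: le_trans (pn x); case: q => q [].
have Ts (q : T) : sublinear (sval q) by case: q => q [].
have Tp (q : T) x : sval q x <= p x by case: q => q [].
pose r (q1 q2 : T) := `[< forall x, sval q2 x <= sval q1 x >].
have [||||q qmin] := @Zorn T r.
- by move=> q; apply/asboolP.
- move=> q1 q2 q3 /asboolP q12 /asboolP q23; apply/asboolP => x.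
  exact: le_trans (q12 x).
- move=> [q1 h1] [q2 h2] /asboolP/= q12 /asboolP/= q21; apply: eq_exist; apply/funext => x.
  by apply/eqP; rewrite eq_le q12 q21.
(* A chain is bounded by its pointwise infimum, the empty chain by [p]. *)
- move=> A Atot; have [[a Aa]|/set0P] := pselect (A !=set0); last first.
    move=> /negP; rewrite negbK => /eqP ->.
    by exists (exist _ p (conj sp (fun=> lexx _))).
  pose q x := inf [set sval i x | i in A].
  have qlb i x : A i -> q x <= sval i x.
    move=> Ai; apply: (@inf_image_le _ _ (fun i : T => sval i x) (- `|x|)) => // j _.
    exact: sublinear_lb.
  have sq : sublinear q.
    apply: inf_sublinear; first by exists a.
    - by move=> i x _; exact: sublinear_lb.
    - move=> i j x y Ai Aj; have [/asboolP ij|/asboolP ji] := Atot i j Ai Aj.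
        by exists j => //; apply: le_trans ((Ts j).1 _ _) _; rewrite lerD2r.
      by exists i => //; apply: le_trans ((Ts i).1 _ _) _; rewrite lerD2l.
    - by move=> i t x Ai t0; exists i => //; exact: (Ts i).2.
  have qp x : q x <= p x by exact: le_trans (qlb a x Aa) _.
  exists (exist _ q (conj sq qp)) => i Ai; apply/asboolP => x /=; exact: qlb.
have {}qmin (q' : X -> R) : sublinear q' -> (forall x, q' x <= sval q x) ->
    forall x, sval q x <= q' x.
  move=> sq' q'q x.
  have q'p z : q' z <= p z by exact: le_trans (q'q z) _.
  have := qmin (exist _ q' (conj sq' q'p)) _; move=> <- //.
  exact/asboolP.
move: q (Ts q) (Tn q) (Tp q) qmin => [/= q _] sq qn qp qmin.
have qDge x y : q x + q y <= q (x + y).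
  pose F (t : R) z : R := q (z + t *: y) - t * q y.
  have Flb (t : R) z : 0 <= t -> - `|z| <= F t z.
    move=> t0; have := sq.1 (z + t *: y) (- z); rewrite addrAC subrr add0r.
    rewrite (sublinear_hom _ sq)// /F; have := qn (- z); rewrite normrN; lra.
  have inf_le t z : 0 <= t -> inf [set F t z | t in [set t | 0 <= t]] <= F t z.
    move=> t0; apply: (@inf_image_le _ _ (fun t => F t z) (- `|z|)) => // s s0.
    exact: Flb.
  pose G z := inf [set F t z | t in [set t | 0 <= t]].
  have sG : sublinear G.
    apply: (@inf_sublinear _ [set t : R | 0 <= t] F); first by exists 0 => /=.
    - by move=> t z /= t0; exact: Flb.
    - move=> s t u v s0 t0; exists (s + t); first exact: addr_ge0.
      rewrite /F; have := sq.1 (u + s *: y) (v + t *: y).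
      by rewrite addrACA -scalerDl; lra.
    - move=> s t u s0 t0; exists (t * s); first by apply: mulr_ge0 => //; exact: ltW.
      rewrite /F -scalerA -scalerDr (sublinear_hom _ sq qn (ltW t0)).
      by rewrite mulrBr mulrA.
  have Gq z : G z <= q z.
    apply: le_trans (inf_le 0 z _) _ => //.
    by rewrite /F scale0r addr0 mul0r subr0.
  have := le_trans (qmin G sG Gq x) (inf_le 1 x ler01).
  by rewrite /F scale1r; lra.
have qD x y : q (x + y) = q x + q y.
  by apply/eqP; rewrite eq_le sq.1 qDge.
have q0 : q 0 = 0 by exact: sublinear0.
have qN x : q (- x) = - q x.
  by apply/eqP; rewrite -addr_eq0 -qD addNr q0.
exists q; split=> // [a x y|x]; last first.
  by rewrite ler_norml qn sublinear_lb.
rewrite qD; congr (_ + _); have [a0|a0] := leP 0 a; first by rewrite (sublinear_hom _ sq qn a0).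
rewrite -[a]opprK scaleNr qN (sublinear_hom _ sq qn) ?mulNr//.
by rewrite oppr_ge0 ltW.
Qed.

(** Hahn-Banach is applied to the infimum of [|v - t (z - x)| - t d] over [t >= 0] and [z] in [Z]. A
    linear [g] below it is below the norm (take [t = 0]) and has [g (z - x) <= - d] (take [t = 1],
    [v = z - x]). *)
Lemma separation (Z : set X) x (d : R) : convex Z -> Z !=set0 ->
  (forall z, Z z -> d <= `|x - z|) ->
  exists g : X -> R, [/\ (forall a x y, g (a *: x + y) = a * g x + g y),
    forall x, `|g x| <= `|x| & forall z, Z z -> g z + d <= g x].
Proof.
move=> Zc [z0 Zz0] dZ.
pose D := [set tz : R * X | 0 <= tz.1 /\ Z tz.2].
pose F (tz : R * X) v := `|v - tz.1 *: (tz.2 - x)| - tz.1 * d.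
have Flb tz v : D tz -> - `|v| <= F tz v.
  case: tz => t z [/= t0 Zz]; rewrite /F/=.
  have := ler_normB v (v - t *: (z - x)).
  rewrite opprB addrC subrK normrZ ger0_norm// distrC.
  have := ler_wpM2l t0 (dZ z Zz); lra.
have inf_le tz v : D tz -> inf [set F tz v | tz in D] <= F tz v.
  move=> Dtz; apply: (@inf_image_le _ _ (fun t => F t v) (- `|v|)) => // s s0.
  exact: Flb.
have [||g [glin gle gn]] := @hahn_banach (fun v => inf [set F tz v | tz in D]).
- apply: inf_sublinear => //; first by exists (0, z0); split => /=.
  + move=> [s y] [t z] u v [/= s0 Zy] [/= t0 Zz].
    have [st0|st0] := ltP 0 (s + t); last first.
      have [-> ->] : s = 0 /\ t = 0 by split; lra.
      exists (0, z) => //; rewrite /F/= !scale0r !mul0r !subr0; exact: ler_normD.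
    exists (s + t, (s / (s + t)) *: y + (1 - s / (s + t)) *: z).
      split=> /=; first exact: ltW.
      apply: Zc => //; rewrite divr_ge0 ?(ltW st0)//= ler_pdivrMr// mul1r; lra.
    rewrite /F/= mulrDl.
    suff -> : u + v - (s + t) *: (s / (s + t) *: y + (1 - s / (s + t)) *: z - x)
      = (u - s *: (y - x)) + (v - t *: (z - x)).
      have := ler_normD (u - s *: (y - x)) (v - t *: (z - x)); lra.
    rewrite addrACA -opprD; congr (_ - _).
    rewrite !scalerDr !scalerA !scalerN.
    have -> : (s + t) * (s / (s + t)) = s by rewrite mulrC divfK// gt_eqF.
    have -> : (s + t) * (1 - s / (s + t)) = t.
      by rewrite mulrBr mulr1 mulrC divfK ?gt_eqF// addrC addKr.
    by rewrite scalerDl opprD addrACA.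
  + move=> [s y] t u [/= s0 Zy] t0; exists (t * s, y).
      by split=> //=; apply: mulr_ge0 => //; exact: ltW.
    rewrite /F/= -scalerA -scalerBr normrZ gtr0_norm// mulrBr mulrA; lra.
- move=> v; apply: le_trans (inf_le (0, z0) v _) _; first by split => /=.
  by rewrite /F/= scale0r mul0r !subr0.
exists g; split=> // z Zz.
have := le_trans (gle (z - x)) (inf_le (1, z) (z - x) _).
rewrite /F/= scale1r subrr normr0 mul1r => /(_ (conj ler01 Zz)).
by have := glin (- 1) x z; rewrite scaleN1r addrC => ->; lra.
Qed.

Lemma norming x : exists g : X -> R,
  [/\ (forall a x y, g (a *: x + y) = a * g x + g y),
    forall x, `|g x| <= `|x| & g x = `|x|].
Proof.
have [|||g [glin gn gx]] := @separation [set 0] x `|x|.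
- by move=> y z t -> -> _; rewrite !scaler0 addr0.
- by exists 0.
- by move=> z ->; rewrite subr0.
exists g; split=> //; apply/eqP; rewrite eq_le (le_trans (ler_norm _) (gn x))/=.
have g0 : g 0 = 0 by have := glin 1 0 0; rewrite scaler0 addr0 mul1r; lra.
by have := gx 0 erefl; rewrite g0 add0r.
Qed.

Lemma lin_continuous (g : X -> R) :
  (forall a x y, g (a *: x + y) = a * g x + g y) ->
  (forall x, `|g x| <= `|x|) -> cont_linear_functional g.
Proof.
move=> glin gn; split=> // x; apply/cvgrPdist_le => e e0.
near=> y.
have -> : g x - g y = g (x - y).
  by have := glin (- 1) y x; rewrite scaleN1r addrC => ->; lra.
apply: le_trans (gn _) _; near: y.
by apply: (@cvgr_dist_le _ _ _ _ _ id x) => //; exact: cvg_id.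
Unshelve. all: by end_near.
Qed.

End HahnBanach.

(** * Boundedness of weakly compact sets *)

Lemma expr_small (R : realType) (l e : R) : 0 <= l < 1 -> 0 < e ->
  exists n, l ^+ n < e.
Proof.
move=> /andP[l0 l1] e0.
have l1' : `|l| < 1 by rewrite ger0_norm.
have := cvg_expr l1' => /cvgr0Pnorm_lt /(_ _ e0) [n _ nP].
by exists n; have := nP n (leqnn n); rewrite /= ger0_norm// exprn_ge0.
Qed.

Section Bounded.
Context {R : realType} {X : normedModType R}.
Implicit Types (x y z : X).

Lemma functional_bounded (C : set X) (f : X -> R) :
  weakly_compact C -> cont_linear_functional f ->
  exists M, forall x, C x -> `|f x| <= M.
Proof.
move=> Cc fc.
have [|x _|n [g gC]] := Cc nat (fun n => [set x | `|f x| < n%:R]).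
- move=> n x /= fx; exists 1%N, (fun=> f), (n%:R - `|f x|); split => //.
    by rewrite subr_gt0.
  move=> y /= /(_ ord0) fyx; have := ler_normD (f y - f x) (f x).
  rewrite subrK; lra.
- exists (Num.bound (f x)) => //=; have := archi_boundP (normr_ge0 (f x)).
  by rewrite /Num.bound normr_id.
- exists (\sum_(i < n) (g i)%:R) => x /gC [i _ /= /ltW fx].
  by apply: le_trans fx _; rewrite (bigD1 i)//= lerDl sumr_ge0.
Qed.

(* Gliding hump: if [C] contained points [x n] of norm at least [2 n 3^(n+1)],
   a suitable signed series of norming functionals would be unbounded on [C]. *)
Lemma weakly_compact_bounded (C : set X) : weakly_compact C ->
  exists M, forall x, C x -> `|x| <= M.
Proof.
move=> Cc; apply: contrapT => /forallNP Cunb.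
have far n : exists x, C x /\ n%:R * 2 * 3 ^+ n.+1 <= `|x|.
  have /existsNP[x /not_implyP[Cx xn]] := Cunb (n%:R * 2 * 3 ^+ n.+1).
  by exists x; split=> //; rewrite leNgt; apply/negP => /ltW.
have [xs /all_and2[Cxs xsn]] := choice far.
have [fs fsP] := choice (fun n => norming (xs n)).
(* The sign of each new term is that of the partial sum at [xs m], so nothing cancels there:
   [|F m.+1 (xs m)|] is at least [3^-(m+1) |xs m|]. *)
pose F := fix F (n : nat) : X -> R := if n isn't m.+1 then fun=> 0 else
  fun x => F m x +
    (if 0 <= F m (xs m) then 1 else - 1) * (3 ^- m.+1 * fs m x).
have e3 n : 0 < 3 ^- n :> R by rewrite invr_gt0 exprn_gt0.
have e3S n : 3 ^- n = 3 * 3 ^- n.+1 :> R.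
  by rewrite exprS invfM mulrA mulfV ?mul1r.
have FD n a x y : F n (a *: x + y) = a * F n x + F n y.
  elim: n => [|n IHn] /=; first by rewrite mulr0 addr0.
  by rewrite IHn; have [-> _ _] := fsP n; ring.
have FB n m x : `|F (n + m)%N x - F n x| <= (3 ^- n - 3 ^- (n + m)) / 2 * `|x|.
  elim: m => [|m IHm]; first by rewrite addn0 !subrr normr0 mul0r mul0r.
  rewrite addnS /=; set s := (if _ then _ else _).
  have sn : `|s| = 1 by rewrite /s; case: ifP; rewrite ?normrN normr1.
  have [_ /(_ x) fn _] := fsP (n + m)%N.
  have : `|s * (3 ^- (n + m).+1 * fs (n + m)%N x)| <= 3 ^- (n + m).+1 * `|x|.
    by rewrite !normrM sn mul1r gtr0_norm// ler_pM2l.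
  rewrite addrAC; move: (s * _) => t tn.
  have := ler_normD (F (n + m)%N x - F n x) t.
  have := e3S (n + m)%N => e3Snm; rewrite e3Snm in IHm; lra.
(* The limit of the [F n], written as the infimum of upper bounds with geometric tail [3^-n / 2]; by
   [FF] every lower bound lies below every upper bound. *)
pose G x := inf [set F n x + 3 ^- n / 2 * `|x| | n in [set: nat]].
have FF n m x : F n x - 3 ^- n / 2 * `|x| <= F m x + 3 ^- m / 2 * `|x|.
  have xn := normr_ge0 x.
  have [nm|/ltnW mn] := leqP n m.
    have := FB n (m - n)%N x; rewrite subnKC// ler_norml => /andP[].
    have := mulr_ge0 (ltW (e3 m)) xn; lra.
  have := FB m (n - m)%N x; rewrite subnKC// ler_norml => /andP[].
  have := mulr_ge0 (ltW (e3 n)) xn; lra.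
have GF n x : `|G x - F n x| <= 3 ^- n / 2 * `|x|.
  rewrite ler_distl; apply/andP; split.
    by apply: le_inf_image; [exists 0%N|move=> m _; exact: FF].
  apply: (@inf_image_le _ _ _ (fun n => F n x + 3 ^- n / 2 * `|x|)
    (F 0%N x - 3 ^- 0 / 2 * `|x|)) => // m _; exact: FF.
have Glin a x y : G (a *: x + y) = a * G x + G y.
  apply/eqP; rewrite -subr_eq0 -normr_le0; apply/ler_addgt0Pr => /= e epos.
  rewrite add0r.
  pose K := `|a *: x + y| + `|a| * `|x| + `|y| + 1.
  have K0 : 0 < K by rewrite /K ltr_wpDl// !addr_ge0// mulr_ge0.
  have le3 : 0 <= (3^-1 : R) < 1 by rewrite invr_ge0 ler0n invf_lt1 ?ltr1n.
  have [n] := @expr_small R 3^-1 (e / K) le3 (divr_gt0 epos K0).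
  rewrite exprVn ltr_pdivlMr// => ne.
  have -> : G (a *: x + y) - (a * G x + G y) =
    (G (a *: x + y) - F n (a *: x + y)) - a * (G x - F n x) - (G y - F n y).
    by rewrite FD; ring.
  have := GF n (a *: x + y); have := GF n y.
  have := ler_wpM2l (normr_ge0 a) (GF n x); rewrite -normrM.
  move: (G (a *: x + y) - _) (a * _) (G y - _) => u v w vn wn un.
  have := ler_normB (u - v) w; have := ler_normB u v.
  rewrite /K in ne; have := e3 n; have := normr_ge0 y; move: (3 ^- n) ne un vn wn => h; lra.
have Gn x : `|G x| <= `|x|.
  have := GF 0%N x; rewrite /= subr0 expr0 invr1; have := normr_ge0 x; lra.
have [M MP] := functional_bounded Cc (lin_continuous Glin Gn).
have [n Mn] : exists n : nat, M < n%:R.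
  exists (Num.bound M); apply: le_lt_trans (ler_norm M) _.
  by have := archi_boundP (normr_ge0 M); rewrite /Num.bound normr_id.
have := MP _ (Cxs n); apply/negP; rewrite -ltNge; apply: lt_le_trans Mn _.
(* The tail after [F n.+1] eats at most half of the last term, so [|G (xs n)|] is at least [n],
   which exceeds [M]. *)
have := GF n.+1 (xs n); have [_ _ fx] := fsP n.
have : 3 ^- n.+1 * `|xs n| <= `|F n.+1 (xs n)|.
  rewrite /= fx; have := mulr_ge0 (ltW (e3 n.+1)) (normr_ge0 (xs n)).
  case: ifPn => [F0|]; last rewrite -ltNge => F0.
    by move=> ?; rewrite mul1r ger0_norm; lra.
  by move=> ?; rewrite mulN1r ler0_norm; lra.
have : n%:R * 2 <= 3 ^- n.+1 * `|xs n| by rewrite ler_pdivlMl ?exprn_gt0// mulrC.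
have := ler_normB (G (xs n)) (G (xs n) - F n.+1 (xs n)).
rewrite opprB addrC subrK; lra.
Qed.

End Bounded.

(** * The cm condition for finitely many points *)

Section CM.
Context {R : realType} {X : normedModType R}.
Implicit Types (x y z : X).

Lemma limn_esup_le (u : nat -> \bar R) (c : \bar R) :
  (forall i, (u i <= c)%E) -> (limn_esup u <= c)%E.
Proof.
move=> uc; rewrite /limn_esup limf_esupE.
apply: (@le_trans _ _ (ereal_sup (u @` setT))).
  by apply: ereal_inf_lbound; exists setT => //; exact: filterT.
by apply: ge_ereal_sup => _ [i _ <-].
Qed.

Lemma le_limn_esup (u : nat -> \bar R) (c : \bar R) :
  (forall i, (c <= u i)%E) -> (c <= limn_esup u)%E.
Proof.
move=> cu; rewrite /limn_esup limf_esupE.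
apply: le_ereal_inf_tmp => _ [V VF <-].
have [i Vi] := @filter_ex _ \oo _ V VF.
by apply: le_trans (cu i) _; apply: ereal_sup_ubound; exists i.
Qed.

(* Applying the sequential condition to a periodic sequence. *)
Lemma cm_pointwise (C : set X) (T : X -> X) n (p : 'I_n.+1 -> X) y (c : R) :
  cm_nonexpansive C T -> C y -> (forall k, C (p k)) -> 0 <= c ->
  (forall A : {set 'I_n.+1}, `|\sum_(k in A) (p k - y)| <= c) ->
  forall A : {set 'I_n.+1}, `|\sum_(k in A) (T (p k) - T y)| <= c.
Proof.
move=> [_ Tcm] Cy Cp c0 pc A.
(* The window [i+1, ..., i+n+1] of the periodic sequence meets each point once; [h i] reindexes its
   subset sums. *)
pose h i (k : 'I_n.+1) : 'I_n.+1 := inord ((i + k.+1) %% n.+1).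
have h_inj i : injective (h i).
  move=> k l /(congr1 (@nat_of_ord _)); rewrite /h !inordK ?ltn_pmod// => /eqP.
  by rewrite eqn_modDl -addn1 -(addn1 l) eqn_modDr !modn_small// => /eqP/val_inj.
pose u j := p (inord (j %% n.+1)).
have := Tcm n.+1 y u Cy (fun=> Cp _); rewrite -lee_fin.
move=> Tle; apply: le_trans; last apply: le_trans Tle _.
  apply: le_limn_esup => i; rewrite lee_fin.
  have -> : \sum_(k in A) (T (p k) - T y) =
      \sum_(k in h i @^-1: A) ((T \o u) (i + k.+1)%N - T y).
    have {1}-> : A = h i @: (h i @^-1: A).
      apply/setP => k; apply/idP/imsetP => [kA|[l]]; last by rewrite inE => ? ->.
      by exists (invF (@h_inj i) k); rewrite ?inE f_invF.
    by rewrite big_imset//= => k l _ _; exact: h_inj.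
  exact: (le_bigmax _ (fun A : {set 'I_n.+1} =>
    `|\sum_(k in A) ((T \o u) (i + k.+1)%N - T y)|)).
apply: limn_esup_le => i; rewrite lee_fin; apply: bigmax_le => // B _.
have -> : \sum_(k in B) (u (i + k.+1)%N - y) = \sum_(k in h i @: B) (p k - y).
  by rewrite big_imset//= => k l _ _; exact: h_inj.
exact: pc.
Qed.

End CM.

(** * Weak limits and minimal invariant sets *)

Section Weak.
Context {R : realType} {X : normedModType R}.
Implicit Types (x y z : X) (C K S Z : set X).

Lemma norm_conv c x y (t : R) : 0 <= t <= 1 ->
  `|c - (t *: x + (1 - t) *: y)| <= t * `|c - x| + (1 - t) * `|c - y|.
Proof.
move=> /andP[t0 t1].
have -> : c - (t *: x + (1 - t) *: y) = t *: (c - x) + (1 - t) *: (c - y).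
  by rewrite !scalerBr addrACA -scalerDl subrKC scale1r opprD.
by apply: le_trans (ler_normD _ _) _; rewrite !normrZ !ger0_norm// subr_ge0.
Qed.

Lemma convex_ball (c : X) (r : R) : convex [set z | `|c - z| <= r].
Proof.
move=> x y t /= xr yr t01; apply: le_trans (norm_conv _ _ _ t01) _.
by move/andP: t01 => [t0 t1]; nra.
Qed.

(** Mazur's theorem: this set is the complement of the norm closure of [Z]. Half of the gap [d] of a
    separating functional survives on a weak neighbourhood. *)
Lemma weak_open_away Z : convex Z -> Z !=set0 ->
  weak_open [set x | exists2 d : R, 0 < d & forall z, Z z -> d <= `|x - z|].
Proof.
move=> Zc Z0 x [d d0 dZ]; have [g [glin gn gZ]] := separation Zc Z0 dZ.
exists 1%N, (fun=> g), (d / 2); split=> [|_|y /= /(_ ord0) gyx].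
- by rewrite divr_gt0.
- exact: lin_continuous.
- exists (d / 2) => [|z Zz]; first by rewrite divr_gt0.
  apply: le_trans (gn (y - z)); apply: le_trans (ler_norm _).
  have := glin (- 1) z y; rewrite scaleN1r addrC => ->.
  have := gZ z Zz; move: gyx; rewrite ltr_distl => /andP[]; lra.
Qed.

Definition weak_lim (U : set_system X) o := forall G, weak_open G -> G o -> U G.

(** Otherwise weakly open sets outside [U] cover [C]; for a finite subcover the complements all lie
    in [U], as does [C], yet they have no common point in [C]. *)
Lemma weakly_compact_ultra C (U : set_system X) : weakly_compact C ->
  UltraFilter U -> U C -> exists2 o, C o & weak_lim U o.
Proof.
move=> Cc UU UC; apply: contrapT => noo.
pose I := {G : set X | weak_open G /\ ~ U G}.
have [|x Cx|n [g gC]] := Cc I (fun G => sval G).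
- by case=> G [].
- apply: contrapT => nG; apply: noo; exists x => // G Go Gx.
  by apply: contrapT => nUG; apply: nG; exists (exist _ G (conj Go nUG)).
- have Ung : U (fun x => forall i, (~` sval (g i)) x).
    apply: filter_forall => i.
    by have [//|] := in_ultra_setVsetC (sval (g i)) UU; case: (g i) => G [].
  have [x [Cx ngx]] := filter_ex (filterI UC Ung).
  by have [i _ /ngx] := gC x Cx.
Qed.

(** If [Z] kept a positive distance from [o], the set of [weak_open_away] would be a weak
    neighbourhood of [o], hence a member of [U] disjoint from [Z]. *)
Lemma weak_lim_closure (U : set_system X) o Z (d : R) : ProperFilter U ->
  weak_lim U o -> convex Z -> U Z -> 0 < d -> exists2 z, Z z & `|o - z| < d.
Proof.
move=> UU Uo Zc UZ d0; apply: contrapT => nz.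
have Z0 : Z !=set0 by exact: filter_ex UZ.
have Uaway := Uo _ (weak_open_away Zc Z0) _.
have [|z [Zz [e e0 /(_ z Zz)]]] := filter_ex (filterI UZ (Uaway _)); last first.
  by rewrite subrr normr0 leNgt e0.
exists d => // z Zz; rewrite leNgt; apply/negP => zd; apply: nz; by exists z.
Qed.

(** Norm closedness relative to [C], which [C] itself satisfies trivially. *)
Definition rel_closed C S := forall x, C x ->
  (forall d : R, 0 < d -> exists2 z, S z & `|x - z| < d) -> S x.

Definition invariant_subset C (T : X -> X) S :=
  [/\ S `<=` C, S !=set0, convex S, (forall x, S x -> S (T x)) & rel_closed C S].

Lemma minimal_invariant C T : C !=set0 -> convex C -> weakly_compact C ->
  (forall x, C x -> C (T x)) ->
  exists2 K, invariant_subset C T K &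
    forall S, invariant_subset C T S -> S `<=` K -> K `<=` S.
Proof.
move=> C0 Cc Cw CT.
have CI : invariant_subset C T C by split=> // x.
pose I := {S | invariant_subset C T S}.
pose r (S1 S2 : I) := `[< sval S2 `<=` sval S1 >].
have [||||K Kmin] := @Zorn I r.
- by move=> S; exact/asboolP.
- move=> S1 S2 S3 /asboolP S12 /asboolP S23; apply/asboolP.
  exact: subset_trans S12.
- move=> [S1 h1] [S2 h2] /asboolP/= S12 /asboolP/= S21; apply: eq_exist.
  exact/seteqP.
- move=> A Atot; have [[a Aa]|A0] := pselect (A !=set0); last first.
    by exists (exist _ C CI) => S AS; exfalso; apply: A0; exists S.
  pose B := [set x | forall S : I, A S -> sval S x].
  suff BI : invariant_subset C T B.
    by exists (exist _ B BI) => S AS; apply/asboolP => x /= /(_ S AS).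
  have AI (S : I) : invariant_subset C T (sval S) by case: S.
  split=> [x /(_ a Aa)||x y t Bx By t01 S AS|x Bx S AS|x Cx xB S AS]; last first.
  + have [_ _ _ _ Scl] := AI S; apply: Scl => // d /xB[z Bz zd].
    by exists z => //; exact: Bz.
  + by have [_ _ _ ST _] := AI S; exact/ST/Bx.
  + by have [_ _ Sc _ _] := AI S; apply: Sc => //; [exact: Bx|exact: By].
  (* If the intersection is empty, the complements of the closures of the chain's members cover [C];
     a point of the smallest member in a finite subcover is then left uncovered. *)
  + apply: contrapT => B0.
    pose J := {S : I | A S}.
    have [j|x Cx|n [g gC]] := Cw J (fun S : J => [set x | exists2 d : R, 0 < d &
        forall z, sval (sval S) z -> d <= `|x - z|]).
    * by have [_ S0 Sc _ _] := AI (sval j); exact: weak_open_away.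
    * apply: contrapT => nU; apply: B0; exists x => S AS.
      have [_ _ _ _ Scl] := AI S; apply: Scl => // d d0.
      apply: contrapT => nz; apply: nU; exists (exist _ S AS) => //.
      exists d => //= z Sz; rewrite leNgt; apply/negP => zd; apply: nz.
      by exists z.
    * have [S AS Sg] : exists2 S : I, A S & forall i, sval S `<=` sval (sval (g i)).
        elim: n g {gC} => [|n IHn] g; first by exists a => // -[].
        have [S AS Sg] := IHn (fun i => g (lift ord0 i)).
        have [/asboolP Sg0|/asboolP g0S] := Atot _ _ AS (svalP (g ord0)).
          exists (sval (g ord0)); first exact: svalP.
          by move=> i; have [j ->|->//] := unliftP ord0 i; exact: subset_trans Sg0 (Sg j).
        by exists S => // i; have [j ->|->] := unliftP ord0 i.
      have [SC [x Sx] _ _ _] := AI S.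
      have [i _ [d d0 /(_ x (Sg i x Sx))]] := gC x (SC x Sx).
      by rewrite subrr normr0 leNgt d0.
  + by have [SC _ _ _ _] := AI a; exact: SC.
exists (sval K); first exact: svalP.
move=> S SI SK; have := Kmin (exist _ S SI) => <- //; exact/asboolP.
Qed.

End Weak.

(** * Approximate fixed points *)

Section GoebelKarlovitz.
Context {R : realType} {X : normedModType R}.
Implicit Types (x y z : X) (C K S Z : set X).

Definition approx_fix K (T : X -> X) (e : R) := [set w | K w /\ `|T w - w| < e].

(** Picard iterates from [y] of [b |-> l T b + (1 - l) y], an [l]-contraction when [T] is
    nonexpansive; on a bounded set its fixed point is almost fixed by [T] for [l] near 1. *)
Definition damped (T : X -> X) (l : R) y n :=
  iter n (fun b => l *: T b + (1 - l) *: y) y.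

Lemma dampedS T l y n :
  damped T l y n.+1 = l *: T (damped T l y n) + (1 - l) *: y.
Proof. by []. Qed.

Lemma damped_in K T (l : R) y n : convex K -> (forall x, K x -> K (T x)) ->
  0 <= l <= 1 -> K y -> K (damped T l y n).
Proof. by move=> Kc KT l01 Ky; elim: n => //= n IHn; apply: Kc => //; exact: KT. Qed.

Lemma damped_approx_fix K T (D e : R) : convex K ->
  (forall x, K x -> K (T x)) -> nonexpansive_on K T ->
  (forall x y, K x -> K y -> `|x - y| <= D) -> 0 < e ->
  exists l n, 0 <= l <= 1 /\
    forall y, K y -> approx_fix K T e (damped T l y n).
Proof.
move=> Kc KT Tn KD e0.
have [[y0 Ky0]|K0] := pselect (exists y, K y); last first.
  by exists 0, 0%N; split=> [|y Ky]; [rewrite lexx ler01|case: K0; exists y].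
have D0 : 0 <= D by apply: le_trans (KD y0 y0 Ky0 Ky0).
have E0 : 0 < e + 2 * (D + 1) by lra.
(* The damping factor is [1 - s]. Then [T b - b] is one step of the iteration, of norm at most
   [(1 - s)^n D], plus [s (T b - y)], of norm at most [s D]; both are made less than [e / 2], and
   [D + 1] covers [D = 0]. *)
pose s := e / (e + 2 * (D + 1)).
have s0 : 0 < s by exact: divr_gt0.
have s1 : s < 1 by rewrite /s ltr_pdivrMr//; lra.
have sD : s * D < e / 2 by rewrite /s mulrAC ltr_pdivrMr//; nra.
have l01 : 0 <= 1 - s < 1 by apply/andP; split; lra.
have [|n nl] := @expr_small R _ (e / (2 * (D + 1))) l01.
  by apply: divr_gt0 => //; lra.
have l01' : 0 <= 1 - s <= 1 by apply/andP; split; lra.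
exists (1 - s), n; split=> // y Ky.
have Kb j : K (damped T (1 - s) y j) by exact: damped_in.
have step j : `|damped T (1 - s) y j.+1 - damped T (1 - s) y j| <= (1 - s) ^+ j * D.
  elim: j => [|j IHj]; first by rewrite mul1r; exact: KD (Kb 1%N) (Kb 0%N).
  rewrite dampedS [X in _ - X]dampedS [- (_ *: _ + _)]opprD addrACA subrr addr0 -scalerBr.
  rewrite normrZ ger0_norm; last by lra.
  rewrite exprS -mulrA ler_wpM2l//; first lra.
  exact: le_trans (Tn _ _ (Kb _) (Kb _)) IHj.
split=> //; move: (step n); rewrite dampedS.
move: (damped T (1 - s) y n) (Kb n) => b Kbb bn.
have -> : T b - b = ((1 - s) *: T b + (1 - (1 - s)) *: y - b) + s *: (T b - y).
  rewrite subKr scalerBl scale1r -(addrA (T b)) (addrC (- (s *: _))) -scalerBr.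
  by rewrite -(opprB (T b)) scalerN [in RHS]addrAC subrK.
apply: le_lt_trans (ler_normD _ _) _; rewrite normrZ gtr0_norm//.
have := ler_wpM2l (ltW s0) (KD _ _ (KT _ Kbb) Ky).
move: nl; rewrite ltr_pdivlMr; last by lra.
have : 0 <= (1 - s) ^+ n by rewrite exprn_ge0//; lra.
nra.
Qed.

Context {C : set X} {T : X -> X} {K : set X}.
Context (Cw : weakly_compact C) (Tn : nonexpansive_on C T).
Context (KI : invariant_subset C T K).
Context (Kmin : forall S, invariant_subset C T S -> S `<=` K -> K `<=` S).

Let KC : K `<=` C. Proof. by case: KI. Qed.
Let Kc : convex K. Proof. by case: KI. Qed.
Let KT x : K x -> K (T x). Proof. by case: KI => _ _ _ + _; exact. Qed.
Let Kcl : rel_closed C K. Proof. by case: KI. Qed.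
Let TnK : nonexpansive_on K T. Proof. by move=> x y /KC Cx /KC; exact: Tn. Qed.

Lemma weak_lim_in (U : set_system X) : UltraFilter U -> U K ->
  exists2 o, K o & weak_lim U o.
Proof.
move=> UU UK; have UC : U C by exact: filterS UK.
have [a Co Uo] := weakly_compact_ultra Cw UU UC; exists a => //.
by apply: Kcl => // d d0; exact: weak_lim_closure Uo Kc UK d0.
Qed.

(** Minimality first spreads the hypothesis on [z0], up to [e], to every point of [K] (the set
    [S1]). A weak limit of approximate fixed points is then within [r] of all of [K], so [E] is
    nonempty, and minimality makes it [K]. *)
Lemma minimal_diam_le (F : set_system X) z0 (r : R) : ProperFilter F ->
  (forall e, 0 < e -> F (approx_fix K T e)) -> K z0 ->
  F [set w | `|z0 - w| <= r] -> forall z w, K z -> K w -> `|z - w| <= r.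
Proof.
move=> FF FA Kz0 Fz0.
pose S1 := [set z | K z /\ forall e : R, 0 < e -> F [set w | `|z - w| <= r + e]].
have KS1 : K `<=` S1.
  apply: Kmin => [|z []//]; split=> [z [/KC]//||||].
  - exists z0; split=> // e e0; apply: filterS Fz0 => w /=; lra.
  - move=> x y t [Kx Fx] [Ky Fy] t01; split=> [|e e0]; first exact: Kc.
    apply: filterS (filterI (Fx e e0) (Fy e e0)) => w [/= xw yw].
    rewrite distrC; apply: le_trans (norm_conv _ _ _ t01) _.
    by rewrite ![`|w - _|]distrC; move/andP: t01 => [t0 t1]; nra.
  - move=> x [Kx Fx]; split=> [|e e0]; first exact: KT.
    have e20 : 0 < e / 2 by lra.
    apply: filterS (filterI (Fx _ e20) (FA _ e20)) => w [/= xw [Kw Tw]].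
    have := ler_distD (T w) (T x) w; have := TnK Kx Kw; lra.
  - move=> x Cx xcl; split=> [|e e0].
      by apply: Kcl => // d /xcl[z [Kz _] zd]; exists z.
    have e20 : 0 < e / 2 by lra.
    have [z [_ Fz] xz] := xcl _ e20; apply: filterS (Fz _ e20) => w /= zw.
    have := ler_distD z x w; lra.
pose E := [set z | K z /\ forall w, K w -> `|z - w| <= r].
suff KE : K `<=` E by move=> z w /KE[_]; exact.
apply: Kmin => [|z []//]; split=> [z [/KC]//||||].
- have [U [UU FU]] := ultraFilterLemma FF.
  have UK : U K by apply: filterS (FU _ (FA 1 ltr01)) => w [].
  have [a Ko Uo] := weak_lim_in UU UK.
  exists a; split=> // w Kw; apply/ler_addgt0Pr => e e0.
  have e20 : 0 < e / 2 by lra.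
  have [_ /(_ _ e20) Fw] := KS1 w Kw.
  have [z /= zw az] := weak_lim_closure _ Uo (@convex_ball _ _ w (r + e / 2)) (FU _ Fw) e20.
  have := ler_distD z a w; rewrite [`|z - w|]distrC; lra.
- move=> x y t [Kx xr] [Ky yr] t01; split=> [|w Kw]; first exact: Kc.
  rewrite distrC; apply: le_trans (norm_conv _ _ _ t01) _.
  have := xr w Kw; have := yr w Kw.
  by rewrite ![`|w - _|]distrC; move/andP: t01 => [t0 t1]; nra.
- move=> z [Kz zr]; split=> [|w Kw]; first exact: KT.
  (* [T] maps [K] into the ball of radius [r] about [T z], so the part of [K] in that ball is
     invariant and minimality makes it all of [K]. *)
  pose S := [set w | K w /\ `|T z - w| <= r].
  suff KS : K `<=` S by have [] := KS w Kw.
  apply: Kmin => [|v []//]; split=> [v [/KC]//||||].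
  + by exists (T z0); split; [exact: KT|apply: le_trans (TnK Kz Kz0) (zr _ Kz0)].
  + by move=> x y t [Kx xr] [Ky yr] t01; split; [exact: Kc|exact: convex_ball].
  + move=> x [Kx _]; split; first exact: KT.
    exact: le_trans (TnK Kz Kx) (zr _ Kx).
  + move=> x Cx xcl; split.
      by apply: Kcl => // d /xcl[v [Kv _] vd]; exists v.
    apply/ler_addgt0Pr => e /xcl[v [_ vr] xv].
    have := ler_distD v (T z) x; rewrite [`|v - x|]distrC; lra.
- move=> x Cx xcl; split.
    by apply: Kcl => // d /xcl[v [Kv _] vd]; exists v.
  move=> w Kw; apply/ler_addgt0Pr => e /xcl[v [_ vr] xv].
  have := ler_distD v x w; have := vr w Kw; lra.
Qed.

(** If approximate fixed points of every quality came within [D - e] of [z], they would generate a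
    filter to which [minimal_diam_le] applies, against [Dsup]. *)
Lemma goebel_karlovitz (D : R) z (e : R) :
  (forall x y, K x -> K y -> `|x - y| <= D) ->
  (forall d : R, 0 < d -> exists x y, [/\ K x, K y & D - d < `|x - y|]) ->
  K z -> 0 < e ->
  exists2 d : R, 0 < d & forall w, approx_fix K T d w -> D - e <= `|z - w|.
Proof.
move=> KD Dsup Kz e0; apply: contrapT => nd.
have [x [y [Kx Ky xy]]] := Dsup e e0.
suff /(_ x y Kx Ky) : forall x y, K x -> K y -> `|x - y| <= D - e.
  by rewrite leNgt xy.
pose B d := approx_fix K T d `&` [set w | `|z - w| <= D - e].
have BF : ProperFilter (filter_from [set d : R | 0 < d] B).
  apply: filter_from_proper.
    apply: filter_from_filter; first by exists 1 => /=.
    move=> i j /= i0 j0; exists (Num.min i j); first by rewrite /= lt_min i0.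
    by move=> w [[Kw]]; rewrite lt_min => /andP[wi wj] wz; split; split.
  move=> d /= d0; apply: contrapT => nw; apply: nd; exists d => // w wd.
  rewrite leNgt; apply/negP => zw; apply: nw; exists w; split=> //.
  exact: ltW.
apply: (@minimal_diam_le _ z _ BF) => // [d d0|].
  by exists d => // w [].
by exists 1 => [|w []] //=.
Qed.

End GoebelKarlovitz.

(** * The l1-type estimate *)

Section SumLower.
Context {R : realType} {X : normedModType R}.
Implicit Types (x y z : X) (C K S Z : set X).

Lemma weak_lim_functional (U : set_system X) a (f : X -> R) (e : R) :
  Filter U -> weak_lim U a -> cont_linear_functional f -> 0 < e ->
  U [set w | `|f w - f a| < e].
Proof.
move=> UF Ua fc e0; apply: Ua; last by rewrite /= subrr normr0.
move=> x /= xe; exists 1%N, (fun=> f), (e - `|f x - f a|); split=> //.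
  by rewrite subr_gt0.
by move=> y /= /(_ ord0); have := ler_distD (f x) (f y) (f a); lra.
Qed.

Lemma lin_sum (f : X -> R) (I : finType) (A : {set I}) (v : I -> X) :
  (forall a x y, f (a *: x + y) = a * f x + f y) ->
  f (\sum_(k in A) v k) = \sum_(k in A) f (v k).
Proof.
move=> flin; have f0 : f 0 = 0 by have := flin 1 0 0; rewrite scaler0 addr0; lra.
apply: big_morph => // x y; by have := flin 1 x y; rewrite scale1r mul1r.
Qed.

Context {C : set X} {T : X -> X} {K : set X}.
Context (Cw : weakly_compact C) (Tcm : cm_nonexpansive C T).
Context (KI : invariant_subset C T K).
Context (Kmin : forall S, invariant_subset C T S -> S `<=` K -> K `<=` S).
Context (D : R) (D0 : 0 < D).
Context (KD : forall x y, K x -> K y -> `|x - y| <= D).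
Context (Dsup : forall d : R, 0 < d ->
  exists x y, [/\ K x, K y & D - d < `|x - y|]).
Context (U : set_system X) (UU : UltraFilter U).
Context (UA : forall e, 0 < e -> U (approx_fix K T e)).
Context (a : X) (Ka : K a) (Ua : weak_lim U a).

Let KC : K `<=` C. Proof. by case: KI. Qed.
Let Kc : convex K. Proof. by case: KI. Qed.
Let KT x : K x -> K (T x). Proof. by case: KI => _ _ _ + _; exact. Qed.
Let TnK : nonexpansive_on K T.
Proof. by move=> x y /KC Cx /KC; case: Tcm => + _; exact. Qed.

(* Run the damped iteration simultaneously from [y] and from the midpoints of [y]
   and the [p k]. The cm condition keeps the partial sums of the differences
   small, while by Goebel-Karlovitz the iterate [b] started at [y] ends up at
   distance almost [D] from [a]; a functional norming [b - a] then contradicts an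
   upper bound on the norm of the full sum. *)
Lemma late_sum_lower n y (e : R) : K y -> 0 < e ->
  exists2 S, U S & forall p : 'I_n -> X, (forall k, S (p k)) ->
    n%:R * D - e <= `|\sum_k (p k - y)|.
Proof.
move=> Ky e0; case: n => [|n].
  exists setT => [|p _]; first exact: filterT.
  by rewrite mul0r; apply: le_trans (normr_ge0 _); lra.
apply: contrapT => nS.
have n1D : n.+1%:R * D = n%:R * D + D by rewrite -natr1 mulrDl mul1r.
have nD : 0 <= n%:R * D by rewrite mulr_ge0// ltW.
pose c := Num.max (n.+1%:R * D - e) (n%:R * D).
have c0 : 0 <= c by rewrite le_max nD orbT.
have cD : c < n.+1%:R * D by rewrite gt_max n1D ltrBlDr !ltrDl e0.
have ce : n.+1%:R * D - e <= c by rewrite le_max lexx.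
have cn : n%:R * D <= c by rewrite le_max lexx orbT.
move: c c0 cD ce cn => c c0 cD ce cn.
have n10 : 0 < n.+1%:R :> R by rewrite ltr0n.
(* Three errors [h] per term will be lost; as 8 exceeds 6, [(n+1) (D / 2 - 3 h)] still exceeds
   [c / 2]. *)
pose h := (n.+1%:R * D - c) / (8 * n.+1%:R).
have h0 : 0 < h by rewrite divr_gt0 ?subr_gt0// mulr_gt0.
have hE : n.+1%:R * h = (n.+1%:R * D - c) / 8.
  by rewrite /h; field; rewrite gt_eqF.
have [d d0 dP] := goebel_karlovitz Cw (proj1 Tcm) KI Kmin KD Dsup Ka h0.
have [l [N [l01 lP]]] := damped_approx_fix Kc KT TnK KD d0.
pose b j := damped T l y j.
have Kb j : K (b j) by exact: damped_in.
have bN : D - h <= `|b N - a| by rewrite distrC; apply/dP/lP.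
have [f [flin fn fb]] := norming (b N - a).
have fB x z : f (x - z) = f x - f z.
  by have := flin (- 1) z x; rewrite scaleN1r addrC => ->; lra.
(* Each of the [N] iterations adds an error [s]; together they cost at most [h]. *)
pose s := h / N.+1%:R.
have N10 : 0 < N.+1%:R :> R by rewrite ltr0n.
have s0 : 0 < s by rewrite divr_gt0.
have Ns : N%:R * s <= h.
  by rewrite /s mulrCA ger_pMr// ler_pdivrMr// mul1r ler_nat.
have US := filterI (UA s0) (weak_lim_functional _ Ua (lin_continuous flin fn) h0).
have [p [pS psum]] : exists p : 'I_n.+1 -> X,
    (forall k, (approx_fix K T s `&` [set w | `|f w - f a| < h]) (p k)) /\
    `|\sum_k (p k - y)| < n.+1%:R * D - e.
  apply: contrapT => np; apply: nS; eexists; first exact: US.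
  move=> p pS; rewrite leNgt; apply/negP => psum; apply: np; by exists p.
have Kp k : K (p k) by have [[]] := pS k.
have Tp k : `|T (p k) - p k| < s by have [[]] := pS k.
have fp k : `|f (p k) - f a| < h by have [] := pS k.
(* Starting at midpoints halves the bound [c] on the partial sums and keeps the iterates within
   about [D / 2] of [p k]. *)
pose u0 k := 2^-1 *: p k + (1 - 2^-1) *: y.
have half01 : 0 <= (2^-1 : R) <= 1 by rewrite invr_ge0 ler0n invf_le1// ler1n.
have Ku0 k : K (u0 k) by exact: Kc.
pose u j k := damped T l (u0 k) j.
have Ku j k : K (u j k) by exact: damped_in.
have [l0 l1] : 0 <= l /\ l <= 1 by apply/andP.
have pu j k : `|p k - u j k| <= D / 2 + j%:R * s.
  have pu0 : `|p k - u0 k| <= D / 2.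
    apply: le_trans (norm_conv _ _ _ half01) _.
    by rewrite subrr normr0; have := KD (Kp k) Ky; lra.
  elim: j => [|j IHj]; first by rewrite mul0r addr0.
  rewrite /u dampedS -/(u j k); apply: le_trans (norm_conv _ _ _ l01) _.
  have := ler_distD (T (p k)) (p k) (T (u j k)).
  have := TnK (Kp k) (Ku j k); have := Tp k; rewrite [`|T (p k) - p k|]distrC.
  have -> : j.+1%:R * s = j%:R * s + s by rewrite -natr1 mulrDl mul1r.
  have : 0 <= j%:R * s by rewrite mulr_ge0// ltW.
  move: (j%:R * s) IHj => q; move: `|_ - T (u j k)| => v1 v2 v3 v4 v5 v6.
  have v1D : v1 <= D / 2 + q + s by lra.
  have := ler_wpM2l l0 v1D; nra.
(* Each new difference is a convex combination of a difference of images under [T], whose sums the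
   cm condition controls, and of the initial one. *)
have sum_ub j (A : {set 'I_n.+1}) : `|\sum_(k in A) (u j k - b j)| <= c / 2.
  have u0y (B : {set 'I_n.+1}) : `|\sum_(k in B) (u0 k - y)| <= c / 2.
    have -> : \sum_(k in B) (u0 k - y) = 2^-1 *: \sum_(k in B) (p k - y).
      rewrite scaler_sumr; apply: eq_bigr => k _.
      by rewrite /u0 scalerBl scale1r addrCA addrAC subrr add0r scalerBr.
    rewrite normrZ gtr0_norm; last by rewrite invr_gt0.
    rewrite mulrC ler_pM2r ?invr_gt0//.
    have [->|BT] := eqVneq B [set: 'I_n.+1]%SET.
      apply: le_trans ce; apply: ltW; apply: le_lt_trans psum.
      by rewrite (eq_bigl xpredT)// => k; rewrite inE.
    apply: le_trans cn; apply: le_trans (ler_norm_sum _ _ _) _.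
    apply: (@le_trans _ _ (\sum_(k in B) D)).
      by apply: ler_sum => k _; exact: KD.
    rewrite sumr_const -[_ *+ _]mulr_natl ler_pM2r// ler_nat -ltnS.
    have : (#|B| < #|[set: 'I_n.+1]%SET|)%N.
      by apply: proper_card; rewrite properT.
    by rewrite cardsT card_ord.
  elim: j A => [|j IHj] A; first exact: u0y.
  have -> : \sum_(k in A) (u j.+1 k - b j.+1) =
      l *: (\sum_(k in A) (T (u j k) - T (b j))) +
      (1 - l) *: (\sum_(k in A) (u0 k - y)).
    have step k : u j.+1 k - b j.+1 =
        l *: (T (u j k) - T (b j)) + (1 - l) *: (u0 k - y).
      by rewrite /u /b !dampedS !scalerBr opprD addrACA.
    by rewrite (eq_bigr _ (fun k _ => step k)) big_split/= -!scaler_sumr.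
  apply: le_trans (ler_normD _ _) _; rewrite !normrZ !ger0_norm ?subr_ge0//.
  have := cm_pointwise Tcm (KC (Kb j)) (fun k => KC (Ku j k)) _ IHj A.
  have c20 : 0 <= c / 2 by rewrite divr_ge0.
  by move=> /(_ c20); have := u0y A; nra.
(* [f (b N) - f (u N k)] is at least [D - h] between [b N] and [a], less [h] between [a] and [p k],
   less [D / 2 + h] between [p k] and [u N k]. *)
have := sum_ub N [set: 'I_n.+1]%SET; apply/negP; rewrite -ltNge.
rewrite -normrN -sumrN; apply: lt_le_trans (le_trans (ler_norm _) (fn _)).
rewrite lin_sum//.
apply: (@lt_le_trans _ _ (\sum_(k in [set: 'I_n.+1]%SET) (D / 2 - 3 * h))).
  rewrite sumr_const cardsT card_ord -[(_ - _) *+ _]mulr_natl mulrBr.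
  have -> : n.+1%:R * (3 * h) = 3 * (n.+1%:R * h) by ring.
  by rewrite hE; lra.
apply: ler_sum => k _; rewrite opprB fB.
have := pu N k; have := fn (p k - u N k); rewrite fB distrC.
have := fp k; rewrite ltr_distl => /andP[_ ?].
have := ler_norm (f (u N k) - f (p k)).
by move: fb bN; rewrite fB => <-; lra.
Qed.

End SumLower.

(** * Generic choices along the ultrafilter *)

Section IteratedUltrafilter.
Context {R : realType} {X : normedModType R}.
Implicit Types (x y z v : X) (Z : set X) (P : set (seq X)).

(* [iter_filter U n P]: for [U]-most [z_1], for [U]-most [z_2], and so on up to
   [z_n], the sequence of the [z_i] satisfies [P]. *)
Fixpoint iter_filter (U : set_system X) n : set_system (seq X) :=
  if n is m.+1 then fun P => U [set z | iter_filter U m [set s | P (z :: s)]]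
  else fun P => P [::].

Context (U : set_system X) (UU : UltraFilter U).

#[local] Instance iter_filter_proper n : ProperFilter (iter_filter U n).
Proof.
elim: n => [|n IHn]; apply: Build_ProperFilter_ex => /=.
- by move=> P HP; exists [::].
- by split=> //= P Q PQ; exact: PQ.
- move=> P /filter_ex[z] /filter_ex[s]; by exists (z :: s).
- split=> [|P Q UP UQ|P Q PQ].
  + by apply: filterS filterT => z _ /=; exact: filterT.
  + by apply: filterS (filterI UP UQ) => z [Pz Qz]; exact: filterI.
  + by apply: filterS => z /=; apply: filterS => s /=; exact: PQ.
Qed.

Lemma iter_filterN n P : ~ iter_filter U n P -> iter_filter U n (~` P).
Proof.
elim: n P => [|n IHn] P //= nP.
have [//|] := in_ultra_setVsetC [set z | iter_filter U n [set s | P (z :: s)]] UU.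
by apply: filterS => z /= /IHn.
Qed.

Lemma iter_filter_all n (S : set X) : U S ->
  iter_filter U n [set s | size s = n /\ forall i, (i < n)%N -> S (nth 0 s i)].
Proof.
move=> US; elim: n => [|n IHn]; first by split.
apply: filterS US => z Sz /=; apply: filterS IHn => s /= [<- Ss]; split=> //.
by case=> //= i; exact: Ss.
Qed.

Context (a : X) (Ua : weak_lim U a).

(** Follows the recursion of [iter_filter], one coefficient per chosen point. *)
Fixpoint comb (cs : seq R) (s : seq X) : X :=
  match cs, s with
  | c :: cs', z :: s' => c *: (z - a) + comb cs' s'
  | _, _ => 0
  end.

Lemma comb_mkseq (f : nat -> R) n s : size s = n ->
  comb (mkseq f n) s = \sum_(i < n) f i *: (nth 0 s i - a).
Proof.
elim: n f s => [|n IHn] f [|z s]//= => [_|[sn]]; first by rewrite big_ord0.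
rewrite big_ord_recl/=; congr (_ + _).
have -> : [seq f i | i <- iota 1 n] = mkseq (f \o succn) n.
  by rewrite /mkseq (iotaDl 1 0) -map_comp.
by rewrite IHn.
Qed.

(* As in a spreading model of a weakly null sequence, dropping terms does not
   increase the norm: if the conclusion failed for most [z] in some position with
   coefficient [c != 1], it would fail on a convex set of [U], which comes close to
   the weak limit [a], where the term vanishes. *)
Lemma suppression (cs : seq R) v (r : R) :
  (forall e, 0 < e -> exists2 S, U S &
    forall p : 'I_(count (pred1 1) cs) -> X, (forall k, S (p k)) ->
      r - e <= `|v + \sum_k (p k - a)|) ->
  forall e, 0 < e ->
    iter_filter U (size cs) [set s | r - e <= `|v + comb cs s|].
Proof.
elim: cs v r => [|c cs IHcs] v r sum_lb e e0 /=.
  have [S _ Sp] := sum_lb e e0.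
  by have := Sp (fun=> a); rewrite big_ord0; apply; case.
have e20 : 0 < e / 2 by lra.
have [c1|c1] := eqVneq c 1.
  rewrite /= c1 eqxx in sum_lb; have [S US Sp] := sum_lb _ e20.
  apply: filterS (US) => z Sz /=.
  have sum_lb' e' : 0 < e' -> exists2 S, U S &
      forall p : 'I_(count (pred1 1) cs) -> X, (forall k, S (p k)) ->
        r - e / 2 - e' <= `|v + (z - a) + \sum_k (p k - a)|.
    move=> e'0; exists S => // p pS.
    have := Sp (fun k => if unlift ord0 k is Some j then p j else z).
    rewrite big_ord_recl unlift_none addrA.
    under eq_bigr do rewrite liftK.
    move=> Spz; apply: le_trans (Spz _); first by lra.
    by move=> k; case: unliftP.
  apply: filterS (IHcs _ _ sum_lb' _ e20) => s /=.
  rewrite c1 scale1r => vs; rewrite [v + _]addrA; apply: le_trans vs; lra.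
have IHv : iter_filter U (size cs) [set s | r - e / 2 <= `|v + comb cs s|].
  by apply: IHcs => // e' /sum_lb; rewrite /= (negbTE c1).
pose good z :=
  iter_filter U (size cs) [set s | r - e <= `|v + (c *: (z - a) + comb cs s)|].
have [//|Ubad] := in_ultra_setVsetC [set z | good z] UU; exfalso.
pose Z := [set z | iter_filter U (size cs)
  [set s | `|v + (c *: (z - a) + comb cs s)| <= r - e]].
have UZ : U Z.
  apply: filterS Ubad => z /= /iter_filterN; apply: filterS => s /= /negP.
  by rewrite -ltNge => /ltW.
have Zc : convex Z.
  move=> x y t Zx Zy /andP[t0 t1]; apply: filterS (filterI Zx Zy) => s [/= xs ys].
  have -> : v + (c *: (t *: x + (1 - t) *: y - a) + comb cs s) =
      t *: (v + (c *: (x - a) + comb cs s)) +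
      (1 - t) *: (v + (c *: (y - a) + comb cs s)).
    move: (comb cs s) => w.
    have split3 (b : X) : b = t *: b + (1 - t) *: b.
      by rewrite -scalerDl subrKC scale1r.
    have -> : t *: x + (1 - t) *: y - a = t *: (x - a) + (1 - t) *: (y - a).
      by rewrite [in LHS](split3 a) opprD addrACA -!scalerBr.
    rewrite [in LHS](split3 v) [in LHS](split3 w) scalerDr !scalerA.
    rewrite ![c * _]mulrC -!scalerA (addrACA (t *: (c *: _))).
    by rewrite (addrACA (t *: v)) -!scalerDr.
  apply: le_trans (ler_normD _ _) _; rewrite !normrZ !ger0_norm ?subr_ge0//.
  nra.
(* This [z] is so close to [a] that its term has norm less than [e / 4], whereas [IHv] and
   membership in [Z] force at least [e / 2]. *)
have c0 : 0 < 4 * (`|c| + 1) by have := normr_ge0 c; lra.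
have [z Zz az] := weak_lim_closure _ Ua Zc UZ (divr_gt0 e0 c0).
have [s [/= sv sz]] := filter_ex (filterI IHv Zz).
have := ler_normB (v + (c *: (z - a) + comb cs s)) (c *: (z - a)).
have -> : v + (c *: (z - a) + comb cs s) - c *: (z - a) = v + comb cs s.
  by rewrite addrCA addrAC subrr add0r.
rewrite normrZ distrC.
move: az; rewrite ltr_pdivlMr// => az.
have := normr_ge0 c; have := normr_ge0 (a - z); nra.
Qed.

End IteratedUltrafilter.

(** * The separated family *)

Section SeparatedFamily.
Context {R : realType} {X : normedModType R}.
Implicit Types (x y z : X) (S : set X).
Context {C : set X} {T : X -> X} {K : set X}.
Context (Cw : weakly_compact C) (Tcm : cm_nonexpansive C T).
Context (KI : invariant_subset C T K).
Context (Kmin : forall S, invariant_subset C T S -> S `<=` K -> K `<=` S).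
Context (D : R) (D0 : 0 < D).
Context (KD : forall x y, K x -> K y -> `|x - y| <= D).
Context (Dsup : forall d : R, 0 < d ->
  exists x y, [/\ K x, K y & D - d < `|x - y|]).

Lemma approx_fix_ultra : exists2 U : set_system X, UltraFilter U &
  forall e, 0 < e -> U (approx_fix K T e).
Proof.
have [KC K0 Kc KT _] := KI.
have TnK : nonexpansive_on K T.
  by move=> x y /KC Cx /KC; case: Tcm => + _; exact.
have BF : ProperFilter (filter_from [set e : R | 0 < e] (approx_fix K T)).
  apply: filter_from_proper.
    apply: filter_from_filter; first by exists 1 => /=.
    move=> i j /= i0 j0; exists (Num.min i j); first by rewrite /= lt_min i0.
    by move=> w [Kw]; rewrite lt_min => /andP[wi wj]; split.
  move=> e /= e0; have [l [n [_ ln]]] := damped_approx_fix Kc KT TnK KD e0.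
  by have [y Ky] := K0; exists (damped T l y n); exact: ln.
have [U [UU BU]] := ultraFilterLemma BF.
by exists U => // e e0; apply: BU; exists e.
Qed.

Lemma separated_family n (e : R) : 0 < e -> exists V : 'I_n -> X,
  [/\ forall l, `|V l| <= D, n%:R * D - e <= `|\sum_l V l| &
      forall l m, l != m -> 2 * D - e <= `|V l - V m|].
Proof.
move=> e0; have [U UU UA] := approx_fix_ultra.
have UK : U K by apply: filterS (UA 1 ltr01) => w [].
have [a Ka Ua] := weak_lim_in Cw KI UU UK.
have FU := iter_filter_proper UU.
(* [suppression] keeps only the terms with coefficient 1, and [late_sum_lower] with [y = a] bounds
   these. *)
have comb_lb (f : nat -> R) N m : count (pred1 1) (mkseq f N) = m ->
    iter_filter U N [set s | m%:R * D - e <= `|\sum_(i < N) f i *: (nth 0 s i - a)|].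
  move=> fm; have := @suppression _ _ U UU a Ua (mkseq f N) 0 (m%:R * D).
  rewrite fm size_mkseq => /(_ _ e e0) H.
  have H' : iter_filter U N [set s | m%:R * D - e <= `|0 + comb a (mkseq f N) s|].
    apply: H => e' e'0; have [S US Sp] := late_sum_lower Cw Tcm KI Kmin D0 KD
      Dsup UU UA Ka Ua m Ka e'0.
    by exists S => // p pS; rewrite add0r; exact: Sp.
  apply: filterS (filterI H' (iter_filter_all UU N UK)) => s [/= + [sN _]].
  by rewrite add0r comb_mkseq.
pose V s l := nth 0 s l - nth 0 s (n + l)%N : X.
have [s [[sD sK] [s1 s2]]] : exists s,
    (size s = (n + n)%N /\ forall i, (i < n + n)%N -> K (nth 0 s i)) /\
    (n%:R * D - e <= `|\sum_(l < n) V s l| /\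
     forall lm : 'I_n * 'I_n, lm.1 != lm.2 -> 2 * D - e <= `|V s lm.1 - V s lm.2|).
  apply: (@filter_ex _ (iter_filter U (n + n))).
  apply: filterI; first exact: iter_filter_all.
  apply: filterI.
    pose f i : R := if (i < n)%N then 1 else - 1.
    have fn : count (pred1 1) (mkseq f (n + n)) = n.
      rewrite /mkseq iotaD map_cat count_cat !count_map add0n.
      rewrite (@eq_in_count _ _ predT) ?count_predT ?size_iota; last first.
        by move=> i; rewrite mem_iota add0n /f => /= ->; rewrite eqxx.
      rewrite (@eq_in_count _ _ pred0) ?count_pred0 ?addn0// => i.
      rewrite mem_iota => /andP[ni _] /=; rewrite /f ltnNge ni/=.
      by apply/eqP; lra.
    apply: filterS (comb_lb _ _ _ fn) => s /=.
    suff -> : \sum_(i < n + n) f i *: (nth 0 s i - a) = \sum_(l < n) V s l by [].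
    rewrite big_split_ord/= -big_split/=; apply: eq_bigr => i _.
    rewrite /f ltn_ord ltnNge leq_addr scale1r scaleN1r.
    by rewrite /V opprB addrA subrK.
  apply: filter_forall => -[l m] /=.
  have [lm|lm] := eqVneq l m; first by apply: filterE => s.
  pose d (j i : nat) : R := (i == j)%:R.
  (* Coefficients of [V s l - V s m], in which [a] cancels; exactly two of them are 1, whence
     [2 D]. *)
  pose f i := d l i + d (n + m)%N i - d m i - d (n + l)%N i.
  have f2 : count (pred1 1) (mkseq f (n + n)) = 2.
    have lmN : (l != m :> nat) by [].
    have [ln mn] := (ltn_ord l, ltn_ord m).
    rewrite /mkseq count_map.
    rewrite (@eq_in_count _ _ (predU (pred1 (l : nat)) (pred1 (n + m)%N))).
      have := count_predUI (pred1 (l : nat)) (pred1 (n + m)%N) (iota 0 (n + n)).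
      rewrite !count_uniq_mem ?iota_uniq// !mem_iota.
      have -> : count (predI (pred1 (l : nat)) (pred1 (n + m)%N)) (iota 0 (n + n)) = 0%N.
        by apply/eqP; rewrite -leqn0 leqNgt -has_count; apply/hasP => -[i _ /=]; lia.
      lia.
    move=> i _ /=; rewrite /f /d.
    case: (eqVneq i l) => [il|_]; case: (eqVneq i (n + m)%N) => [inm|_];
      case: (eqVneq i m) => [im|_]; case: (eqVneq i (n + l)%N) => [inl|_] /=;
      first [lia | by apply/eqP; lra].
  apply: filterS (comb_lb _ _ _ f2) => s /=.
  suff -> : \sum_(i < n + n) f i *: (nth 0 s i - a) = V s l - V s m by [].
  have sumd (j : 'I_(n + n)) :
      \sum_(i < n + n) d j i *: (nth 0 s i - a) = nth 0 s j - a.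
    rewrite (bigD1 j)//= /d eqxx scale1r big1 ?addr0// => i.
    by rewrite -val_eqE /= => /negbTE ->; rewrite scale0r.
  under eq_bigr do rewrite /f !scalerBl scalerDl.
  rewrite !sumrB big_split/=.
  rewrite (sumd (lshift n l)) (sumd (rshift n m)) (sumd (lshift n m)).
  rewrite (sumd (rshift n l))/= /V; move: (nth 0 s) => t.
  rewrite -[LHS]addrA addrACA !opprB (addrA (t l - a)) (addrA (t _ - a)) !subrK.
  by rewrite addrACA [RHS]addrACA [- t m + _]addrC.
exists (fun l => V s l); split=> [l||l m lm].
- by apply: KD; apply: sK; rewrite ?ltn_add2l// ltn_addr.
- exact: s1.
- exact: (s2 (l, m)).
Qed.

End SeparatedFamily.

(** * Passage to the modulus and conclusion *)

Lemma eps0_k_ge2 (R : realType) (X : normedModType R) k :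
  (forall e : R, 0 < e -> exists x : 'I_k.+1 -> X,
    sep_family k (2 - e) x /\
    1 - e <= `| (k.+1%:R)^-1 *: \sum_(i < k.+1) x i |) ->
  2 <= @eps0_k R X k.
Proof.
move=> sepX.
have s_ub : has_ubound [set e : R | 0 <= e <= 2 /\
    exists x, @sep_family R X k e x].
  by exists 2 => e [/andP[_ e2] _].
have s_lb d : 0 < d -> d <= 2 -> 2 - d <= @s_k R X k.
  move=> d0 d2; apply: ub_le_sup => //.
  by have [x [xs _]] := sepX d d0; split; [apply/andP; split; lra|exists x].
have avg1 e (x : 'I_k.+1 -> X) : sep_family k e x ->
    `|(k.+1%:R)^-1 *: \sum_(i < k.+1) x i| <= 1.
  move=> [x1 _]; rewrite normrZ ger0_norm ?invr_ge0//.
  rewrite ler_pdivrMl ?ltr0n// mulr1; apply: le_trans (ler_norm_sum _ _ _) _.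
  apply: (@le_trans _ _ (\sum_(i < k.+1) 1)); first exact: ler_sum.
  by rewrite sumr_const card_ord.
(* The families of [sepX] have means of norm near 1, and no mean exceeds 1 by [avg1]; so the modulus
   vanishes on all of [[0, 2)]. *)
have delta0 e : 0 <= e -> e < 2 -> @delta_k R X k e = 0.
  move=> e0 e2; apply/eqP; rewrite eq_le; apply/andP; split; last first.
    apply: lb_le_inf.
      have e20 : 0 < 2 - e by lra.
      have [x [xs _]] := sepX _ e20; rewrite subKr in xs.
      by eexists; exists x; [exact: xs|].
    by move=> _ [x /avg1 x1 <-]; rewrite subr_ge0.
  apply/ler_addgt0Pr => d d0; rewrite add0r.
  (* Two demands: a mean within [d] of norm 1, and separation at least [e]. *)
  pose d' := Num.min d (2 - e).
  have d'0 : 0 < d' by rewrite lt_min d0/=; lra.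
  have d'd : d' <= d by rewrite ge_min lexx.
  have d'e : d' <= 2 - e by rewrite ge_min lexx orbT.
  have [x [[x1 xs] xavg]] := sepX d' d'0.
  apply: (@le_trans _ _ (1 - `|(k.+1%:R)^-1 *: \sum_(i < k.+1) x i|)); last by lra.
  apply: ge_inf.
    by exists 0 => _ [z /avg1 z1 <-]; rewrite subr_ge0.
  by exists x => //; split=> // i j ij; apply: le_trans (xs i j ij); lra.
rewrite leNgt; apply/negP => eps2.
(* The midpoint of [eps0_k] and 2, truncated at 0 to stay in the domain of [delta_k]; it exceeds the
   supremum yet belongs to the set. *)
pose e := Num.max 0 ((@eps0_k R X k + 2) / 2).
have e2 : e < 2 by rewrite gt_max; apply/andP; split; lra.
have e0 : 0 <= e by rewrite le_max lexx.
have ee : (@eps0_k R X k + 2) / 2 <= e by rewrite le_max lexx orbT.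
have : e <= @eps0_k R X k.
  apply: ub_le_sup.
    by exists (@s_k R X k) => r [/andP[_ /ltW]].
  split; last exact: delta0.
  rewrite e0/=; have h0 : 0 < (2 - e) / 2 by lra.
  by apply: lt_le_trans (s_lb _ h0 _); lra.
lra.
Qed.

Unset Implicit Arguments.

Theorem theorem5p1 (R : realType) (X : completeNormedModType R) (k : nat) :
  (0 < k)%N -> @eps0_k R X k < 2 ->
  forall (C : set X), C !=set0 -> convex C -> weakly_compact C ->
  forall (T : X -> X), (forall x, C x -> C (T x)) -> cm_nonexpansive C T ->
  exists x, C x /\ T x = x.
Proof.
move=> _ eps2 C C0 Cc Cw T CT Tcm; apply: contrapT => nofix.
have [K KI Kmin] := minimal_invariant C0 Cc Cw CT.
have [KC [x0 Kx0] _ KT _] := KI.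
have [M MP] := weakly_compact_bounded Cw.
pose E := [set r : R | exists x y, [/\ K x, K y & r = `|x - y|]].
have supE : has_sup E.
  split; first by exists `|x0 - x0|, x0, x0.
  exists (M + M) => _ [x [y [Kx Ky ->]]]; apply: le_trans (ler_normB _ _) _.
  by apply: lerD; apply: MP; exact: KC.
have KD x y : K x -> K y -> `|x - y| <= sup E.
  by move=> Kx Ky; apply: ub_le_sup; [case: supE|exists x, y].
have Dsup d : 0 < d -> exists x y, [/\ K x, K y & sup E - d < `|x - y|].
  move=> d0; have [_ [x [y [Kx Ky ->]]] xy] := sup_adherent d0 supE.
  by exists x, y.
have D0 : 0 < sup E.
  apply: lt_le_trans (KD (T x0) x0 (KT _ Kx0) Kx0).
  rewrite normr_gt0 subr_eq0; apply/eqP => Tx0; apply: nofix.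
  by exists x0; split=> //; exact: KC.
move: eps2; apply/negP; rewrite -leNgt; apply: eps0_k_ge2 => e e0.
(* Tolerance [e D] becomes [e] after rescaling by [D^-1]. *)
have [V [V1 V2 V3]] := separated_family Cw Tcm KI Kmin D0 KD Dsup k.+1
  (mulr_gt0 e0 D0).
move: (sup E) D0 {KD Dsup} V1 V2 V3 => D D0 V1 V2 V3.
exists (fun i => D^-1 *: V i); split; first split=> [i|i j ij].
- by rewrite normrZ gtr0_norm ?invr_gt0// ler_pdivrMl// mulr1.
- rewrite -scalerBr normrZ gtr0_norm ?invr_gt0// ler_pdivlMl//.
  by have := V3 i j ij; lra.
- have k0 : 0 < k.+1%:R :> R by rewrite ltr0n.
  have k1 : 1 <= k.+1%:R :> R by rewrite ler1n.
  rewrite -scaler_sumr !normrZ !gtr0_norm ?invr_gt0//.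
  rewrite ler_pdivlMl// ler_pdivlMl//; apply: le_trans V2.
  have : 0 < e * D by exact: mulr_gt0.
  by nra.
Qed.
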